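(* Let $K$ be a field, $A = K[[X_1,\ldots,X_n]]$, $\mathfrak{m} = (X_1,\ldots,X_n)$, and $R = G_{\mathfrak{m}}(A) \cong K[X_1,\ldots,X_n]$. Let $M$ be a finitely generated $A$-module and assume that the associated graded module $G_{\mathfrak{m}}(M)$ has a pure resolution over $R$. Let $\mathbb{F}$ be a minimal free resolution of $M$ over $A$. Then the complex $\operatorname{in}(\mathbb{F})$ of graded free $R$-modules is a minimal free resolution of $G_{\mathfrak{m}}(M)$.
   Context: $G_{\mathfrak{m}}(A) = \bigoplus_{i\ge 0} \mathfrak{m}^i/\mathfrak{m}^{i+1}$, which is identified with $R=K[X_1,\ldots,X_n]$ with its standard grading, and $G_{\mathfrak{m}}(M) = \bigoplus_{i\ge 0}\mathfrak{m}^iM/\mathfrak{m}^{i+1}M$, a finitely generated graded $R$-module. $E(-d)$ denotes the graded shift $E(-d)_i = E_{i-d}$. Pure resolution: a finitely generated graded $R$-module $E$ of projective dimension $p$ has a pure resolution of type $(d_0,d_1,\ldots,d_p)$ if its minimal graded free resolution has the form $0 \to R(-d_p)^{\beta_p} \to \cdots \to R(-d_1)^{\beta_1} \to R(-d_0)^{\beta_0} \to 0$ (each free module is generated in a single degree). $E$ has a pure resolution if this holds for some type. Initial forms: let $\phi = (a_{ij}) \colon A^r \to A^m$ be a nonzero $A$-linear map, and let $s\ge 0$ be such that $\operatorname{image}\phi \subseteq \mathfrak{m}^sA^m$ but $\operatorname{image}\phi\nsubseteq \mathfrak{m}^{s+1}A^m$. Write $\phi = \sum_{j\ge s}\phi_j$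 with $\phi_j$ a matrix whose entries are homogeneous forms of degree $j$. Then $v(\phi) = s$ is the order of $\phi$, and $\operatorname{in}(\phi) = \phi_s$ (regarded as a matrix over $R$) is the initial form of $\phi$. The complex $\operatorname{in}(\mathbb{F})$: let $\mathbb{F}\colon 0\to F_p \xrightarrow{\phi_p} F_{p-1}\to\cdots\to F_1\xrightarrow{\phi_1}F_0\to 0$ be a minimal free resolution of $M$, with $p = \operatorname{projdim} M$ and $\beta_i = \operatorname{rank}F_i$. Set $c_i = v(\phi_i)$ and $d_i = \sum_{j=1}^i c_j$ for $1\le i\le p$. Then $\operatorname{in}(\mathbb{F})$ is the complex of graded $R$-modules $$0\to R(-d_p)^{\beta_p}\xrightarrow{\operatorname{in}(\phi_p)}R(-d_{p-1})^{\beta_{p-1}}\to\cdots\to R(-d_1)^{\beta_1}\xrightarrow{\operatorname{in}(\phi_1)}R^{\beta_0}\to 0.$$ It carries the augmentation $\epsilon\colon R^{\beta_0} = G_{\mathfrak{m}}(F_0)\to G_{\mathfrak{m}}(M)$ induced by the surjection $F_0\to M$; $\epsilon$ is surjective and $\epsilon\circ\operatorname{in}(\phi_1) = 0$. *)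

(* Defs.v *)
From HB Require Import structures.
From mathcomp Require Import all_boot all_order all_algebra.
From mathcomp Require Import boolp classical_sets functions.
From mathcomp Require Import mpoly.

Set Implicit Arguments.
Unset Strict Implicit.
Unset Printing Implicit Defensive.

Import GRing.Theory.

Local Open Scope ring_scope.

Record mps (n : nat) (K : fieldType) := MPS { mps_coef : 'X_{1..n} -> K }.

Section PowerSeries.
Variables (n : nat) (K : fieldType).
Local Notation A := (mps n K).
Local Notation R := {mpoly K[n]}.
Implicit Types (f g h : A) (m : 'X_{1..n}).

HB.instance Definition _ := gen_eqMixin A.
HB.instance Definition _ := gen_choiceMixin A.

Lemma mpsP f g : (forall m, mps_coef f m = mps_coef g m) -> f = g.
Proof. by case: f g => [f] [g] /= fg; congr MPS; apply: funext. Qed.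

Definition mps_zero : A := MPS (fun=> 0).
Definition mps_opp f : A := MPS (fun m => - mps_coef f m).
Definition mps_add f g : A := MPS (fun m => mps_coef f m + mps_coef g m).
Definition mps_one : A := MPS (fun m => (m == 0%MM)%:R).
(* Exponents k1 + k2 = m have degree at most |m|, so the convolution is taken
   over a finite type.                                                        *)
Definition mps_mul f g : A :=
  MPS (fun m => \sum_(k : 'X_{1..n < (mdeg m).+1, (mdeg m).+1}
                      | m == (k.1 + k.2)%MM)
                   mps_coef f k.1 * mps_coef g k.2).

Fact mps_addA : associative mps_add.
Proof. by move=> f g h; apply: mpsP => m /=; rewrite addrA. Qed.
Fact mps_addC : commutative mps_add.
Proof. by move=> f g; apply: mpsP => m /=; rewrite addrC. Qed.
Fact mps_add0 : left_id mps_zero mps_add.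
Proof. by move=> f; apply: mpsP => m /=; rewrite add0r. Qed.
Fact mps_addN : left_inverse mps_zero mps_opp mps_add.
Proof. by move=> f; apply: mpsP => m /=; rewrite addNr. Qed.

HB.instance Definition _ :=
  GRing.isZmodule.Build A mps_addA mps_addC mps_add0 mps_addN.

(* The ring axioms are transferred from {mpoly K[n]} by truncation.           *)
Let trunc d f : R := \sum_(m : 'X_{1..n < d.+1}) mps_coef f m *: 'X_[m].

Let truncE d f m : (mdeg m <= d)%N -> (trunc d f)@_m = mps_coef f m.
Proof. by move=> md; rewrite /trunc mcoeff_mpoly. Qed.

Let mulE d (p q : R) f g :
  (forall m, (mdeg m <= d)%N -> p@_m = mps_coef f m) ->
  (forall m, (mdeg m <= d)%N -> q@_m = mps_coef g m) ->
  forall m, (mdeg m <= d)%N -> (p * q)@_m = mps_coef (mps_mul f g) m.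
Proof.
move=> pf qg m md; rewrite mcoeffM /=; apply: eq_bigr => -[k1 k2] /= _.
by congr (_ * _); [apply: pf | apply: qg];
   apply: leq_trans md; rewrite -ltnS bmdeg.
Qed.

Let mul_truncE d f g m : (mdeg m <= d)%N ->
  (trunc d f * trunc d g)@_m = mps_coef (mps_mul f g) m.
Proof. by move=> md; apply: (mulE _ _ md) => k kd; exact: truncE. Qed.

Fact mps_mulA : associative mps_mul.
Proof.
move=> f g h; apply: mpsP => m; set d := mdeg m.
have <- : (trunc d f * (trunc d g * trunc d h))@_m
          = mps_coef (mps_mul f (mps_mul g h)) m.
  by apply: (mulE (d := d)) => // k kd; [exact: truncE | exact: mul_truncE].
rewrite mulrA.
by apply: (mulE (d := d)) => // k kd; [exact: mul_truncE | exact: truncE].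
Qed.

Fact mps_mulC : commutative mps_mul.
Proof.
move=> f g; apply: mpsP => m.
by rewrite -(@mul_truncE (mdeg m)) // mulrC mul_truncE.
Qed.

Fact mps_mul1 : left_id mps_one mps_mul.
Proof.
move=> f; apply: mpsP => m; set d := mdeg m.
have <- : (1 * trunc d f)@_m = mps_coef (mps_mul mps_one f) m.
  by apply: (mulE (d := d)) => // k kd; [rewrite mcoeff1 | exact: truncE].
by rewrite mul1r truncE.
Qed.

Fact mps_mulDl : left_distributive mps_mul mps_add.
Proof.
move=> f g h; apply: mpsP => m /=; rewrite -big_split /=.
by apply: eq_bigr => k _; rewrite mulrDl.
Qed.

Fact mps_one_neq0 : mps_one != 0.
Proof.
by apply/eqP => /(congr1 (fun f => mps_coef f 0%MM)) /= /eqP;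
  rewrite eqxx oner_eq0.
Qed.

HB.instance Definition _ := GRing.Zmodule_isComNzRing.Build A
  mps_mulA mps_mulC mps_mul1 mps_mulDl mps_one_neq0.

Definition mps_of_mpoly (p : R) : A := MPS (fun m => p@_m).

Fact mps_of_mpoly_is_zmod_morphism : zmod_morphism mps_of_mpoly.
Proof. by move=> p q; apply: mpsP => m /=; rewrite mcoeffB. Qed.

Fact mps_of_mpoly_is_monoid_morphism : monoid_morphism mps_of_mpoly.
Proof.
split=> [|p q]; apply: mpsP => m /=; first by rewrite mcoeff1.
by rewrite mcoeffM.
Qed.

HB.instance Definition _ :=
  GRing.isZmodMorphism.Build R A mps_of_mpoly mps_of_mpoly_is_zmod_morphism.
HB.instance Definition _ :=
  GRing.isMonoidMorphism.Build R A mps_of_mpoly mps_of_mpoly_is_monoid_morphism.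

Definition mps_hpart (s : nat) (f : A) : R :=
  \sum_(m : 'X_{1..n < s.+1} | mdeg m == s) mps_coef f m *: 'X_[m].

End PowerSeries.

Section Ideals.
Variable B : comNzRingType.

Definition ideal_gen (k : nat) (x : 'I_k -> B) : set B :=
  [set f | exists g : 'I_k -> B, f = \sum_(i < k) g i * x i].

(* I N, the set of finite sums of products a *: u with a in I and u in N      *)
Definition smul (M : lmodType B) (I : set B) (N : set M) : set M :=
  [set x | exists s : seq (B * M),
     (forall p, p \in s -> I p.1 /\ N p.2) /\ x = \sum_(p <- s) p.1 *: p.2].

Fixpoint ideal_pow (I : set B) (i : nat) : set B :=
  if i is j.+1 then smul (M := B^o) I (ideal_pow I j) else setT.

Definition finitely_generated (M : lmodType B) : Prop :=
  exists (k : nat) (g : 'I_k -> M),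
    forall x : M, exists a : 'I_k -> B, x = \sum_(i < k) a i *: g i.

Section Smul.
Variables (M : lmodType B) (I : set B) (N : set M).

Lemma smul0 : smul I N 0.
Proof. by exists [::]; split=> //; rewrite big_nil. Qed.

Lemma smulD x y : smul I N x -> smul I N y -> smul I N (x + y).
Proof.
move=> [s [sP ->]] [t [tP ->]]; exists (s ++ t); split; last by rewrite big_cat.
by move=> p; rewrite mem_cat => /orP[/sP|/tP].
Qed.

Lemma smulZ a x : (forall u, N u -> N (a *: u)) -> smul I N x -> smul I N (a *: x).
Proof.
move=> aN [s [sP ->]]; exists [seq (p.1, a *: p.2) | p <- s]; split.
  by move=> p /mapP[q /sP [? ?] ->] /=; split=> //; apply: aN.
by rewrite big_map scaler_sumr; apply: eq_bigr => p _ /=; rewrite !scalerA mulrC.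
Qed.

Lemma smul_in a x : I a -> N x -> smul I N (a *: x).
Proof.
by move=> Ia Nx; exists [:: (a, x)]; rewrite big_seq1; split=> // p;
  rewrite inE => /eqP ->.
Qed.

End Smul.

Section Powers.
Variable I : set B.

Lemma ideal_pow0 i : ideal_pow I i 0.
Proof. by case: i => //= i; exact: smul0. Qed.

Lemma ideal_powD i a b :
  ideal_pow I i a -> ideal_pow I i b -> ideal_pow I i (a + b).
Proof. by case: i => //= i; exact: smulD. Qed.

Lemma ideal_powZ i a b : ideal_pow I i b -> ideal_pow I i (a * b).
Proof.
elim: i a b => //= i IH a b; apply: (smulZ (M := B^o)) => u; exact: IH.
Qed.

Lemma ideal_powM i j a b :
  ideal_pow I i a -> ideal_pow I j b -> ideal_pow I (i + j) (a * b).
Proof.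
elim: i a => [|i IH] a /=; first by move=> _; exact: ideal_powZ.
case=> s [sP ->] bj; rewrite mulr_suml big_seq.
elim/big_ind: _ => [|x y|p ps]; [exact: smul0|exact: smulD|].
case: (sP p ps) => Ip pi; rewrite -mulrA.
by apply: (smul_in (M := B^o)) => //; exact: IH.
Qed.

End Powers.
End Ideals.

Section Resolutions.
Variables (B : comNzRingType) (I : set B).

(* A sequence 0 -> F_p -> ... -> F_1 -> F_0 with F_i = B^(fs_rank i) (column
   vectors) and p = fs_len; fs_map i is the matrix of F_(i+1) -> F_i.  The
   data is indexed by all of nat; F_i = 0 for i > p, and the vanishing of the
   composites, are imposed in min_free_resolution.                            *)
Record free_seq := FreeSeq {
  fs_len : nat;
  fs_rank : nat -> nat;
  fs_map : forall i, 'M[B]_(fs_rank i, fs_rank i.+1) }.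

(* Minimality is F_(i+1) -> I F_i.  The length is normalised by F_p != 0, so
   that p is the projective dimension over a (graded) local ring; the zero
   module has p = 0 and all ranks 0.                                          *)
Record min_free_resolution (M : lmodType B) (F : free_seq)
    (eps : {linear 'cV[B]_(fs_rank F 0) -> M}) : Prop := {
  mfr_surj : forall x : M, exists u, eps u = x;
  mfr_exact0 : forall u,
    eps u = 0 <-> exists v, u = fs_map F 0 *m v;
  mfr_exact : forall i (u : 'cV[B]_(fs_rank F i.+1)),
    fs_map F i *m u = 0 <-> exists v, u = fs_map F i.+1 *m v;
  mfr_min : forall i (u : 'cV[B]_(fs_rank F i.+1)),
    smul I setT (fs_map F i *m u);
  mfr_bound : forall i, (fs_len F < i)%N -> fs_rank F i = 0%N;
  mfr_len : (0 < fs_len F)%N -> fs_rank F (fs_len F) <> 0%N }.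

End Resolutions.

(* Only degrees i >= 0 are needed: G_m(M) vanishes in negative degrees, hence
   so do all the free modules of its minimal graded resolution.               *)

Section Graded.
Variables (n : nat) (K : fieldType).
Local Notation R := {mpoly K[n]}.

Record graded_module := GradedModule {
  gm_mod :> lmodType R;
  gm_deg : nat -> set gm_mod;
  gm_deg0 : forall i, gm_deg i 0;
  gm_degB : forall i x y, gm_deg i x -> gm_deg i y -> gm_deg i (x - y);
  gm_degZ : forall i j (p : R) x,
    p \is j.-homog -> gm_deg i x -> gm_deg (j + i)%N (p *: x);
  gm_sum : forall x, exists (N : nat) (f : nat -> gm_mod),
    (forall i, gm_deg i (f i)) /\ x = \sum_(i < N) f i;
  gm_direct : forall (N : nat) (f : nat -> gm_mod),
    (forall i, gm_deg i (f i)) -> \sum_(i < N) f i = 0 ->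
    forall i, (i < N)%N -> f i = 0 }.

Definition graded_map (E F : graded_module) (f : E -> F) : Prop :=
  forall i x, @gm_deg E i x -> @gm_deg F i (f x).

(* The degree k component of R(-d), that is R_(k-d)                           *)
Definition rdeg (d k : nat) : set R :=
  [set p : R | if (d <= k)%N then is_true (p \is (k - d).-homog) else p = 0].

Definition free_deg (b d k : nat) : set 'cV[R]_b :=
  [set u | forall j, rdeg d k (u j 0)].

Lemma rdeg0 d k : rdeg d k 0.
Proof. by rewrite /rdeg /=; case: ifP => // _; exact: rpred0. Qed.

Fact free_deg0 b d k : free_deg d k (0 : 'cV[R]_b).
Proof. by move=> j; rewrite mxE; exact: rdeg0. Qed.

Fact free_degB b d k (x y : 'cV[R]_b) :
  free_deg d k x -> free_deg d k y -> free_deg d k (x - y).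
Proof.
move=> xk yk j; move: (xk j) (yk j); rewrite !mxE /rdeg /=; case: ifP => _.
  exact: rpredB.
by move=> -> ->; rewrite subrr.
Qed.

Fact free_degZ b d i j (p : R) (x : 'cV[R]_b) :
  p \is j.-homog -> free_deg d i x -> free_deg d (j + i) (p *: x).
Proof.
move=> pj xi k; move: (xi k); rewrite !mxE /rdeg /=.
case: ifP => [di xk|_ ->]; last by rewrite mulr0; exact: rdeg0.
by rewrite (leq_trans di (leq_addl _ _)) -addnBA //; exact: dhomogM.
Qed.

Fact free_sum b d (x : 'cV[R]_b) : exists (N : nat) (f : nat -> 'cV[R]_b),
  (forall i, free_deg d i (f i)) /\ x = \sum_(i < N) f i.
Proof.
pose N := (\max_(j < b) msize (x j 0%R))%N.
exists (d + N)%N.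
exists (fun i => if (d <= i)%N then map_mx (pihomog mdeg (i - d)) x else 0).
split=> [i j|].
  rewrite /rdeg /=; case: (d <= i)%N; rewrite mxE //; exact: pihomogP.
rewrite big_split_ord /= big1 ?add0r; last first.
  by move=> i _; rewrite leqNgt ltn_ord.
apply/matrixP => j k; rewrite ord1 summxE.
rewrite {1}(@pihomog_partitionE _ _ mdeg N (x j 0)); last first.
  exact: (leq_bigmax (F := fun j => msize (x j 0)) j).
by apply: eq_bigr => i _; rewrite leq_addr addKn mxE.
Qed.

Fact free_direct b d (N : nat) (f : nat -> 'cV[R]_b) :
  (forall i, free_deg d i (f i)) -> \sum_(i < N) f i = 0 ->
  forall i, (i < N)%N -> f i = 0.
Proof.
move=> fP f0 i iN; apply/matrixP => j k; rewrite ord1 mxE.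
have := fP i j; rewrite /rdeg /=; case: ifP => // di fij.
move/matrixP: f0 => /(_ j 0); rewrite summxE mxE.
move/(congr1 (pihomog mdeg (i - d))); rewrite linear0 linear_sum /=.
rewrite (bigD1 (Ordinal iN)) //= big1 ?addr0; first by rewrite pihomog_dE.
move=> l; rewrite -val_eqE /= => li.
have := fP l j; rewrite /rdeg /=; case: ifP => [dl fl|_ ->]; last by rewrite linear0.
apply: pihomog_ne0 fl; apply: contra li => /eqP e.
by rewrite -(subnK dl) e subnK.
Qed.

(* R(-d)^b *)
Definition free_graded (b d : nat) : graded_module :=
  GradedModule (@free_deg0 b d) (@free_degB b d) (@free_degZ b d)
               (@free_sum b d) (@free_direct b d).

(* With F_i read as R(-d_i)^(fs_rank i), the maps of F and eps have degree 0  *)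
Definition graded_seq (E : graded_module) (F : free_seq R) (d : nat -> nat)
    (eps : {linear 'cV[R]_(fs_rank F 0) -> E}) : Prop :=
  graded_map (E := free_graded (fs_rank F 0) (d 0)) eps /\
  (forall i, graded_map (E := free_graded (fs_rank F i.+1) (d i.+1))
                        (F := free_graded (fs_rank F i) (d i))
                        (fun u => fs_map F i *m u)).

(* (X_1, ..., X_n), the homogeneous maximal ideal of R                        *)
Definition irrelevant_ideal : set R := ideal_gen (fun i : 'I_n => 'X_i).

Definition min_graded_free_resolution (E : graded_module) (F : free_seq R)
    (d : nat -> nat) (eps : {linear 'cV[R]_(fs_rank F 0) -> E}) : Prop :=
  min_free_resolution irrelevant_ideal eps /\ graded_seq d eps.

Definition has_pure_resolution_of_type (E : graded_module) (p : nat)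
    (d : nat -> nat) : Prop :=
  exists (F : free_seq R) (eps : {linear 'cV[R]_(fs_rank F 0) -> E}),
    fs_len F = p /\ min_graded_free_resolution d eps.

Definition has_pure_resolution (E : graded_module) : Prop :=
  exists (p : nat) (d : nat -> nat), has_pure_resolution_of_type E p d.

End Graded.

(* (X_1, ..., X_n) in K[[X_1, ..., X_n]]                                      *)
Definition maximal_ideal (n : nat) (K : fieldType) : set (mps n K) :=
  ideal_gen (fun i : 'I_n => mps_of_mpoly 'X_i).
Arguments maximal_ideal {n K}.

Section AssociatedGraded.
Variables (n : nat) (K : fieldType) (M : lmodType (mps n K)).
Local Notation A := (mps n K).
Local Notation R := {mpoly K[n]}.
Local Notation mm := (@maximal_ideal n K).

(* m^i M                                                                      *)
Definition adic (i : nat) : set M := smul (ideal_pow mm i) setT.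

Lemma adic0 i : adic i 0. Proof. exact: smul0. Qed.
Lemma adicD i x y : adic i x -> adic i y -> adic i (x + y).
Proof. exact: smulD. Qed.
Lemma adicZ i a x : adic i x -> adic i (a *: x).
Proof. exact: smulZ. Qed.
Lemma adicN i x : adic i x -> adic i (- x).
Proof. by rewrite -scaleN1r; exact: adicZ. Qed.
Lemma adic_sum i (J : Type) (r : seq J) (P : pred J) (F : J -> M) :
  (forall j, P j -> adic i (F j)) -> adic i (\sum_(j <- r | P j) F j).
Proof. by move=> PF; elim/big_ind: _ => //; [exact: adic0|exact: adicD]. Qed.

Lemma adicM j i a x : ideal_pow mm j a -> adic i x -> adic (j + i) (a *: x).
Proof.
move=> aj [s [sP ->]]; rewrite scaler_sumr big_seq.
apply: adic_sum => p ps; rewrite scalerA.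
by case: (sP p ps) => pi _; apply: smul_in => //; exact: ideal_powM.
Qed.

Lemma ideal_pow_mpolyX (m : 'X_{1..n}) : ideal_pow mm (mdeg m) (mps_of_mpoly 'X_[m]).
Proof.
have [d md] : exists d, mdeg m = d by exists (mdeg m).
elim: d m md => [|d IH] m md; first by rewrite md.
have /existsP[i mi] : [exists i, m i != 0%N].
  have : mdeg m != 0%N by rewrite md.
  by rewrite {1}mdegE sum_nat_eq0 negb_forall.
have Um : (U_(i) <= m)%MM.
  by apply/mnm_lepP => j; rewrite mnm1E; case: eqP => // <-; rewrite lt0n.
rewrite md -(submK Um) addmC mpolyXD rmorphM /=.
apply: (smul_in (M := A^o)).
  exists (fun j => (j == i)%:R); rewrite (bigD1 i) //= eqxx mul1r big1 ?addr0 //.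
  by move=> j /negbTE ->; rewrite mul0r.
have dU : mdeg (m - U_(i))%MM = d.
  by move: md; rewrite -{1}(submK Um) mdegD mdeg1 addn1 => -[].
by rewrite -{1}dU; exact: IH.
Qed.

(* The degree j part of a polynomial, as a power series                       *)
Definition hpart (j : nat) (p : R) : A := mps_of_mpoly (pihomog mdeg j p).

Lemma ideal_pow_hpart j p : ideal_pow mm j (hpart j p).
Proof.
rewrite /hpart pihomogE rmorph_sum /=.
elim/big_ind: _ => [|a b|m /eqP <-]; [exact: ideal_pow0|exact: ideal_powD|].
by rewrite -mul_mpolyC rmorphM /=; apply: ideal_powZ; exact: ideal_pow_mpolyX.
Qed.

Lemma hpartD j p q : hpart j (p + q) = hpart j p + hpart j q.
Proof. by rewrite /hpart linearD rmorphD. Qed.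

Lemma hpartX j c m :
  hpart j (c *: 'X_[m]) = if mdeg m == j then mps_of_mpoly (c *: 'X_[m]) else 0.
Proof.
by rewrite /hpart linearZ /= pihomogX; case: eqP; rewrite // scaler0 rmorph0.
Qed.

(* The direct sum of the m^i M, as finitely supported sequences               *)
Definition rees_pred : {pred nat -> M} := fun u =>
  `[< (forall i, adic i (u i)) /\
      (exists N, forall i, (N <= i)%N -> u i = 0) >].

Fact rees_zmod_closed : zmod_closed rees_pred.
Proof.
split.
  by apply/asboolP; split=> [i|]; [exact: adic0|exists 0%N].
move=> u v /asboolP[um [N uN]] /asboolP[vm [N' vN]]; apply/asboolP; split.
  by move=> i; apply: adicD => //; exact: adicN.
exists (maxn N N') => i; rewrite geq_max => /andP[Ni N'i].
by rewrite -[LHS]/(u i - v i) uN // vN // subr0.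
Qed.

HB.instance Definition _ :=
  GRing.isZmodClosed.Build (nat -> M) rees_pred rees_zmod_closed.

Record rees := Rees { rees_seq :> nat -> M; _ : rees_seq \in rees_pred }.

HB.instance Definition _ := [isSub for rees_seq].
HB.instance Definition _ := [Choice of rees by <:].
HB.instance Definition _ := [SubChoice_isSubZmodule of rees by <:].

Implicit Types (u v : rees) (p q : R).

Lemma rees_adic u i : adic i (u i).
Proof. by have /asboolP[] := valP u. Qed.

Lemma rees_finite u : exists N, forall i, (N <= i)%N -> u i = 0.
Proof. by have /asboolP[] := valP u. Qed.

Lemma reesP u v : (forall i, u i = v i) -> u = v.
Proof. by move=> uv; apply: val_inj; apply: funext. Qed.

Lemma reesD u v i : (u + v) i = u i + v i. Proof. by []. Qed.
Lemma reesB u v i : (u - v) i = u i - v i. Proof. by []. Qed.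
Lemma rees0 i : (0 : rees) i = 0. Proof. by []. Qed.
Lemma rees_sum (J : Type) (r : seq J) (P : pred J) (F : J -> rees) i :
  (\sum_(j <- r | P j) F j) i = \sum_(j <- r | P j) F j i.
Proof. exact: (big_morph (fun u : rees => u i) (fun u v => reesD u v i) (rees0 i)). Qed.

(* The action of R on sequences: X^a maps m^i M to m^(i + |a|) M              *)
Definition rees_act p (u : nat -> M) : nat -> M :=
  fun k => \sum_(j < k.+1) hpart j p *: u (k - j)%N.

Fact rees_act_subproof p u : rees_act p u \in rees_pred.
Proof.
apply/asboolP; split=> [k|].
  apply: adic_sum => j _; rewrite -[X in adic X](subnKC (leq_ord j)).
  by apply: adicM; [exact: ideal_pow_hpart | exact: rees_adic].
have [N uN] := rees_finite u; exists (msize p + N)%N => k pNk.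
rewrite /rees_act big1 // => j _; have [pj|jp] := leqP (msize p) j; last first.
  by rewrite uN ?scaler0 // leq_subRL ?leq_ord //; apply: leq_trans pNk; rewrite leq_add2r ltnW.
rewrite /hpart (@pihomogwE _ _ mdeg j (msize p)) // big1 ?rmorph0 ?scale0r //.
by move=> m /eqP mj; have := bmdeg m; rewrite mj ltnNge pj.
Qed.

Definition rees_scale p u : rees := Rees (rees_act_subproof p u).

Lemma rees_scaleDr p : {morph rees_scale p : u v / u + v}.
Proof.
move=> u v; apply: reesP => k; rewrite reesD /= /rees_act -big_split /=.
by apply: eq_bigr => j _; rewrite scalerDr.
Qed.

Lemma rees_scaleDl u : {morph rees_scale^~ u : p q / p + q}.
Proof.
move=> p q; apply: reesP => k; rewrite reesD /= /rees_act -big_split /=.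
by apply: eq_bigr => j _; rewrite hpartD scalerDl.
Qed.

Lemma rees_scale0r p : rees_scale p 0 = 0.
Proof. by apply: (@addrI _ (rees_scale p 0)); rewrite -rees_scaleDr !addr0. Qed.
Lemma rees_scale0l u : rees_scale 0 u = 0.
Proof. by apply: (@addrI _ (rees_scale 0 u)); rewrite -rees_scaleDl !addr0. Qed.

Lemma rees_scaleXE c m u k : rees_scale (c *: 'X_[m]) u k =
  if (mdeg m <= k)%N then mps_of_mpoly (c *: 'X_[m]) *: u (k - mdeg m)%N else 0.
Proof.
rewrite /= /rees_act; case: leqP => mk; last first.
  rewrite big1 // => j _; rewrite hpartX; case: eqP => [mj|_]; last by rewrite scale0r.
  by have := ltn_ord j; rewrite -mj ltnS leqNgt mk.
have mk' : (mdeg m < k.+1)%N by [].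
rewrite (bigD1 (Ordinal mk')) //= hpartX eqxx big1 ?addr0 // => j.
by rewrite -val_eqE /= hpartX eq_sym => /negbTE ->; rewrite scale0r.
Qed.

Lemma rees_scaleA p q u : rees_scale p (rees_scale q u) = rees_scale (p * q) u.
Proof.
elim/mpolyind: p => [|c m p _ _ IH]; first by rewrite mul0r !rees_scale0l.
rewrite mulrDl !rees_scaleDl {}IH; congr (_ + _).
elim/mpolyind: q => [|d m' q _ _ IH].
  by rewrite mulr0 !rees_scale0l rees_scale0r.
rewrite mulrDr !rees_scaleDl rees_scaleDr {}IH; congr (_ + _).
apply: reesP => k.
have -> : c *: 'X_[m] * (d *: 'X_[m']) = (c * d) *: 'X_[m + m'] :> R.
  by rewrite mpolyXD -scalerAl -scalerAr scalerA.
rewrite !rees_scaleXE mdegD; have [mk|mk] := leqP (mdeg m) k; last first.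
  by rewrite ifN // -ltnNge (leq_trans mk) // leq_addr.
rewrite leq_subRL //; case: ifP => _; last by rewrite scaler0.
rewrite scalerA subnDA -rmorphM; congr (mps_of_mpoly _ *: _).
by rewrite mpolyXD -scalerAl -scalerAr scalerA.
Qed.

Lemma rees_scale1 u : rees_scale 1 u = u.
Proof.
apply: reesP => k; have -> : 1 = 1 *: 'X_[0%MM] :> R by rewrite mpolyX0 scale1r.
by rewrite rees_scaleXE mdeg0 /= subn0 mpolyX0 scale1r rmorph1 scale1r.
Qed.

HB.instance Definition _ := GRing.Zmodule_isLmodule.Build R rees
  rees_scaleA rees_scale1 rees_scaleDr (fun u p q => rees_scaleDl u p q).

(* The direct sum of the m^(i+1) M, inside that of the m^i M                  *)
Definition gr_rel : {pred rees} := fun u => `[< forall i, adic i.+1 (u i) >].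

Fact gr_rel_zmod_closed : zmod_closed gr_rel.
Proof.
split; first by apply/asboolP => i; exact: adic0.
move=> u v /asboolP um /asboolP vm; apply/asboolP => i; rewrite reesB.
by apply: adicD => //; exact: adicN.
Qed.

HB.instance Definition _ :=
  GRing.isZmodClosed.Build rees gr_rel gr_rel_zmod_closed.

Lemma gr_relZ p u : u \in gr_rel -> p *: u \in gr_rel.
Proof.
move=> /asboolP um; apply/asboolP => k; apply: adic_sum => j _.
rewrite -[X in adic X.+1](subnKC (leq_ord j)) -addnS.
by apply: adicM => //; exact: ideal_pow_hpart.
Qed.

(* G(M), the sum of the m^i M / m^(i+1) M                                     *)
Definition gr : Type := Quotient.quot gr_rel.
HB.instance Definition _ := GRing.Zmodule.on gr.

Definition gr_pi (u : rees) : gr := (\pi_(Quotient.quot gr_rel) u)%qT.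

Lemma gr_piP (x : gr) : exists u, x = gr_pi u.
Proof. by exists (repr x); rewrite /gr_pi reprK. Qed.

Fact gr_pi_is_zmod_morphism : zmod_morphism gr_pi.
Proof. by move=> u v; rewrite /gr_pi raddfB. Qed.

HB.instance Definition _ :=
  GRing.isZmodMorphism.Build rees gr gr_pi gr_pi_is_zmod_morphism.

Lemma gr_pi_eq u v : (gr_pi u = gr_pi v) <-> (u - v \in gr_rel).
Proof. by rewrite Quotient.idealrBE; split=> /eqP. Qed.

Lemma gr_pi_eq0 u : (gr_pi u = 0) <-> (forall i, adic i.+1 (u i)).
Proof. by rewrite -(raddf0 gr_pi) gr_pi_eq subr0; split=> /asboolP. Qed.

Definition gr_scale p (x : gr) : gr := gr_pi (p *: repr x).

Lemma gr_scaleE p u : gr_scale p (gr_pi u) = gr_pi (p *: u).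
Proof.
apply/gr_pi_eq; rewrite -scalerBr; apply: gr_relZ.
by apply/gr_pi_eq; rewrite /gr_pi reprK.
Qed.

Fact gr_scaleA p q x : gr_scale p (gr_scale q x) = gr_scale (p * q) x.
Proof. by have [u ->] := gr_piP x; rewrite !gr_scaleE scalerA. Qed.
Fact gr_scale1 : left_id 1 gr_scale.
Proof. by move=> x; have [u ->] := gr_piP x; rewrite gr_scaleE scale1r. Qed.
Fact gr_scaleDr : right_distributive gr_scale +%R.
Proof.
move=> p x y; have [u ->] := gr_piP x; have [v ->] := gr_piP y.
by rewrite -raddfD !gr_scaleE scalerDr raddfD.
Qed.
Fact gr_scaleDl x : {morph gr_scale^~ x : p q / p + q}.
Proof.
by move=> p q; have [u ->] := gr_piP x; rewrite !gr_scaleE scalerDl raddfD.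
Qed.

HB.instance Definition _ :=
  GRing.Zmodule_isLmodule.Build R gr gr_scaleA gr_scale1 gr_scaleDr gr_scaleDl.

Lemma gr_piZ p u : gr_pi (p *: u) = p *: gr_pi u.
Proof. by rewrite -gr_scaleE. Qed.

(* The class in m^i M / m^(i+1) M of x, when x is in m^i M (and else 0)       *)
Definition gr_class (i : nat) (x : M) : gr :=
  gr_pi (insubd (0 : rees) (fun j => if j == i then x else 0)).

Definition gr_deg (i : nat) : set gr := gr_class i @` adic i.

Lemma single_rees i x : adic i x -> (fun j => if j == i then x else 0) \in rees_pred.
Proof.
move=> xi; apply/asboolP; split=> [j|]; first by case: eqP => [->|_] //; exact: adic0.
by exists i.+1 => j ij; rewrite gtn_eqF.
Qed.

Lemma gr_classE i x (xi : adic i x) : gr_class i x = gr_pi (Rees (single_rees xi)).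
Proof.
congr gr_pi; apply: val_inj; rewrite val_insubd ifT //; exact: single_rees.
Qed.

Lemma gr_class_eq0 i x : adic i x -> (gr_class i x = 0) <-> adic i.+1 x.
Proof.
move=> xi; rewrite (gr_classE xi) gr_pi_eq0 /=; split=> [/(_ i)|x1 j].
  by rewrite eqxx.
by case: eqP => [->|_] //; exact: adic0.
Qed.

Lemma gr_classD i x y : adic i x -> adic i y ->
  gr_class i (x + y) = gr_class i x + gr_class i y.
Proof.
move=> xi yi; rewrite (gr_classE xi) (gr_classE yi) (gr_classE (adicD xi yi)).
rewrite -raddfD; congr gr_pi; apply: reesP => j; rewrite reesD /=.
by case: eqP; rewrite ?addr0.
Qed.

Lemma gr_class0 i : gr_class i 0 = 0.
Proof. by apply/gr_class_eq0; exact: adic0. Qed.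

Lemma gr_classN i x : adic i x -> gr_class i (- x) = - gr_class i x.
Proof.
move=> xi; apply/eqP; rewrite -addr_eq0 addrC -gr_classD //; last exact: adicN.
by rewrite subrr gr_class0.
Qed.

Lemma gr_classZ i j p x : p \is j.-homog -> adic i x ->
  p *: gr_class i x = gr_class (j + i) (mps_of_mpoly p *: x).
Proof.
move=> pj xi.
have px : adic (j + i) (mps_of_mpoly p *: x).
  by apply: adicM => //; rewrite -(pihomog_dE pj); exact: ideal_pow_hpart.
rewrite (gr_classE xi) (gr_classE px) -gr_piZ; congr gr_pi.
have hp l : hpart l p = if l == j then mps_of_mpoly p else 0.
  rewrite /hpart; case: eqP => [->|/eqP lj]; first by rewrite pihomog_dE.
  by rewrite (pihomog_ne0 _ pj) ?rmorph0 // eq_sym.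
apply: reesP => k /=; rewrite /rees_act; case: eqP => [->|/eqP kji].
  have jk : (j < (j + i).+1)%N by rewrite ltnS leq_addr.
  rewrite (bigD1 (Ordinal jk)) //= hp eqxx addKn eqxx big1 ?addr0 // => l.
  by rewrite -val_eqE /= hp => /negbTE ->; rewrite scale0r.
rewrite big1 // => l _; rewrite hp; case: eqP => [lj|_]; last by rewrite scale0r.
case: eqP => [li|_]; last by rewrite scaler0.
by case/eqP: kji; rewrite -lj -li subnKC // leq_ord.
Qed.

Fact gr_deg0 i : gr_deg i 0.
Proof. by exists 0; [exact: adic0 | exact: gr_class0]. Qed.

Fact gr_degB i x y : gr_deg i x -> gr_deg i y -> gr_deg i (x - y).
Proof.
move=> [a ai <-] [b bi <-]; have bi' := adicN bi.
by exists (a - b); [exact: adicD | rewrite gr_classD // gr_classN].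
Qed.

Fact gr_degZ i j p x : p \is j.-homog -> gr_deg i x -> gr_deg (j + i) (p *: x).
Proof.
move=> pj [a ai <-]; exists (mps_of_mpoly p *: a); last by rewrite (gr_classZ pj).
by apply: adicM => //; rewrite -(pihomog_dE pj); exact: ideal_pow_hpart.
Qed.

Fact gr_sum x : exists (N : nat) (f : nat -> gr),
  (forall i, gr_deg i (f i)) /\ x = \sum_(i < N) f i.
Proof.
have [u ->] := gr_piP x; have [N uN] := rees_finite u.
exists N, (fun i => gr_class i (u i)); split.
  by move=> i; exists (u i) => //; exact: rees_adic.
under eq_bigr => i _ do rewrite (gr_classE (rees_adic u i)).
rewrite -raddf_sum; congr gr_pi; apply: reesP => k; rewrite rees_sum /=.
have [Nk|kN] := leqP N k.
  by rewrite uN // big1 // => i _; rewrite gtn_eqF // (leq_trans (ltn_ord i)).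
rewrite (bigD1 (Ordinal kN)) //= eqxx big1 ?addr0 // => i.
by rewrite -val_eqE eq_sym /= => /negbTE ->.
Qed.

Fact gr_direct (N : nat) (f : nat -> gr) :
  (forall i, gr_deg i (f i)) -> \sum_(i < N) f i = 0 ->
  forall i, (i < N)%N -> f i = 0.
Proof.
move=> fP; have /choice[x xP] : forall i, exists x, adic i x /\ gr_class i x = f i.
  by move=> i; case: (fP i) => x xi xf; exists x.
under eq_bigr => i _ do rewrite -(xP i).2 (gr_classE (xP i).1).
rewrite -raddf_sum => /gr_pi_eq0 s0 i iN; rewrite -(xP i).2.
apply/(gr_class_eq0 (xP i).1); have := s0 i; rewrite rees_sum /=.
rewrite (bigD1 (Ordinal iN)) //= eqxx big1 ?addr0 // => j.
by rewrite -val_eqE eq_sym /= => /negbTE ->.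
Qed.

Definition associated_graded : graded_module n K :=
  GradedModule gr_deg0 gr_degB gr_degZ gr_sum gr_direct.

(* For aug : F_0 -> M with F_0 = A^b, the induced map from G(F_0) = R^b to
   G(M): it is R-linear and sends e_j to the class of aug e_j in M / m M.     *)
Definition gr_aug (b : nat) (aug : 'cV[A]_b -> M) (u : 'cV[R]_b) : gr :=
  \sum_(j < b) u j 0 *: gr_class 0 (aug (delta_mx j 0)).

Fact gr_aug_is_linear b (aug : 'cV[A]_b -> M) : linear (gr_aug aug).
Proof.
move=> p u v; rewrite /gr_aug scaler_sumr -big_split /=.
by apply: eq_bigr => j _; rewrite !mxE scalerDl scalerA.
Qed.

HB.instance Definition _ b (aug : 'cV[A]_b -> M) :=
  GRing.isLinear.Build R 'cV[R]_b gr _ (gr_aug aug) (gr_aug_is_linear aug).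

Lemma gr_augE b (aug : {linear 'cV[A]_b -> M}) k (u : 'cV[R]_b) :
  (forall j, u j 0 \is k.-homog) ->
  gr_aug aug u = gr_class k (aug (map_mx (@mps_of_mpoly n K) u)).
Proof.
move=> uk; rewrite /gr_aug.
have a0 x : adic 0 x by rewrite -[x]scale1r; exact: smul_in.
have -> : map_mx (@mps_of_mpoly n K) u =
          \sum_(j < b) mps_of_mpoly (u j 0) *: delta_mx j 0.
  by rewrite [LHS]matrix_sum_delta; apply: eq_bigr => j _; rewrite big_ord1 mxE.
have uj j : adic k (mps_of_mpoly (u j 0) *: aug (delta_mx j 0)).
  rewrite -[X in adic X]addn0; apply: adicM => //.
  by rewrite -(pihomog_dE (uk j)); exact: ideal_pow_hpart.
rewrite linear_sum; under [in RHS]eq_bigr => j _ do rewrite linearZ.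
have -> : \sum_(j < b) u j 0 *: gr_class 0 (aug (delta_mx j 0)) =
    \sum_(j < b) gr_class k (mps_of_mpoly (u j 0) *: aug (delta_mx j 0)).
  by apply: eq_bigr => j _; rewrite (gr_classZ (uk j) (a0 _)) addn0.
suff /(_ (index_enum _)) [_ ->] : forall s : seq 'I_b,
  let x := \sum_(j <- s) mps_of_mpoly (u j 0) *: aug (delta_mx j 0) in
  adic k x /\ gr_class k x =
    \sum_(j <- s) gr_class k (mps_of_mpoly (u j 0) *: aug (delta_mx j 0)) by [].
elim=> [|j s [xk IH]] /=; first by rewrite !big_nil gr_class0; split=> //; exact: adic0.
by rewrite !big_cons gr_classD // IH; split=> //; exact: adicD.
Qed.

End AssociatedGraded.

Arguments adic {n K M}.
Arguments gr_class {n K M}.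
Arguments associated_graded {n K} M.

Section InitialForms.
Variables (n : nat) (K : fieldType).
Local Notation A := (mps n K).
Local Notation R := {mpoly K[n]}.

Definition has_order (m r : nat) (phi : 'M[A]_(m, r)) (s : nat) : Prop :=
  (forall u : 'cV[A]_r, adic s (phi *m u)) /\
  ~ (forall u : 'cV[A]_r, adic s.+1 (phi *m u)).

(* v(phi), with value 0 for phi = 0                                           *)
Definition order (m r : nat) (phi : 'M[A]_(m, r)) : nat :=
  xget 0%N [set s | has_order phi s].

Definition initial_form (m r : nat) (phi : 'M[A]_(m, r)) : 'M[R]_(m, r) :=
  map_mx (mps_hpart (order phi)) phi.

Definition initial_seq (F : free_seq A) : free_seq R :=
  FreeSeq (fs_len F) (fun i => initial_form (fs_map F i)).

(* d_i = c_1 + ... + c_i, where c_(j+1) = v(fs_map F j)                       *)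
Definition initial_shift (F : free_seq A) (i : nat) : nat :=
  \sum_(j < i) order (fs_map F j).

End InitialForms.

(* Main.v *)
Require Import Defs.
From HB Require Import structures.
From mathcomp Require Import all_boot all_order all_algebra.
From mathcomp Require Import boolp classical_sets functions.
From mathcomp Require Import mpoly.

(** Write N_0 = M and let N_(i+1) be the kernel of F_i -> N_i, so that N_(i+1)
    is a submodule of the free module F_i.  The m-adic filtration of F_i induces
    a filtration on N_(i+1), whose associated graded module is the initial
    module of N_(i+1), a submodule of R^(b_i).  The theorem holds because, by
    purity, this induced filtration is the m-adic filtration of N_(i+1) up to a
    shift of degrees, so that passing to associated graded modules preserves
    exactness at every step of the resolution.

    In detail, the initial module of N_1 is the kernel of R^(b_0) -> G(M), as
    every element of m^k M is the image of an element of m^k F_0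
    ([is_init_aug]).  Suppose that the initial module Z of N = N_(i+1) is known,
    and that it is isomorphic to the corresponding syzygy module in the pure
    resolution, by an invertible matrix of constants ([compared]).  Then Z is
    the image of a matrix Psi all of whose entries are forms of one degree e.
    Lift the columns of Psi to elements of N, the columns of a matrix Y.
    Division by Y, which converges because A is complete, shows that N lies in
    m^e F_i and that every element of N in m^(e + k) F_i is Y a with a in m^k
    ([init_order], [init_division]).  Both Y and the matrix phi of
    F_(i+1) -> F_i are minimal systems of generators of N, so that phi = Y P
    with P invertible modulo m.  Hence phi has order e, its initial form is Psi
    times the constant part of P, and its image is Z: the complex of initial
    forms is exact here.  The division property makes phi strict for the
    filtrations, so that the kernel of the initial form of phi is the initial
    module of the kernel of phi; this is the same situation one step further
    ([compared_next]).

    Exactness thus comes by induction along the resolution.  The remaining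
    claims (degrees, minimality, ranks) are read off the matrices. *)

Local Open Scope ring_scope.

Section PureResolutions.

Set Implicit Arguments.
Unset Strict Implicit.
Unset Printing Implicit Defensive.

Import GRing.Theory.

Variables (n : nat) (K : fieldType).
Local Notation A := (mps n K).
Local Notation R := {mpoly K[n]}.
Local Notation mm := (@maximal_ideal n K).
Local Notation emb := (map_mx (@mps_of_mpoly n K)).

(** * Orders and leading forms of matrices of power series *)

Lemma mps_coefB (f g : A) t : mps_coef (f - g) t = mps_coef f t - mps_coef g t.
Proof. by []. Qed.

Lemma mps_coef_sum (J : Type) (s : seq J) (P : pred J) (f : J -> A) t :
  mps_coef (\sum_(j <- s | P j) f j) t = \sum_(j <- s | P j) mps_coef (f j) t.
Proof. exact: (big_morph (fun f : A => mps_coef f t)). Qed.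

Lemma mcoeff_hpart k (f : A) t :
  (mps_hpart k f)@_t = if mdeg t == k then mps_coef f t else 0.
Proof.
rewrite /mps_hpart big_mkcond /=.
have [tk|kt] := leqP k.+1 (mdeg t).
  rewrite gtn_eqF // raddf_sum big1 // => i _ /=.
  case: eqP => _; last by rewrite mcoeff0.
  rewrite mcoeffZ mcoeffX; case: eqP => [it|_]; last by rewrite mulr0.
  by have := bmdeg i; rewrite it ltnNge tk.
rewrite raddf_sum (bigD1 (BMultinom kt)) //= big1 ?addr0; last first.
  move=> i; rewrite -val_eqE /= => it; case: eqP => _; last by rewrite mcoeff0.
  by rewrite mcoeffZ mcoeffX (negbTE it) mulr0.
by case: eqP; rewrite ?mcoeff0 // mcoeffZ mcoeffX eqxx mulr1.
Qed.

(** All entries in the k-th power of the maximal ideal ([ideal_powP]), stated on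
    coefficients to make products and infinite sums easy to handle. *)
Definition mxord k m r (U : 'M[A]_(m, r)) : Prop :=
  forall i j t, (mdeg t < k)%N -> mps_coef (U i j) t = 0.

Definition mxhomog k m r (W : 'M[R]_(m, r)) : Prop :=
  forall i j, W i j \is k.-homog.

Definition lead k m r (U : 'M[A]_(m, r)) : 'M[R]_(m, r) :=
  map_mx (mps_hpart k) U.

Definition mxcomp k m r (W : 'M[R]_(m, r)) : 'M[R]_(m, r) :=
  map_mx (pihomog mdeg k) W.

Section Orders.
Variables m r : nat.
Implicit Types (U V : 'M[A]_(m, r)) (W : 'M[R]_(m, r)).

Lemma mxord0 U : mxord 0 U. Proof. by []. Qed.

Lemma mxord_le k l U : (l <= k)%N -> mxord k U -> mxord l U.
Proof. by move=> lk Uk i j t tl; apply: Uk; exact: leq_trans lk. Qed.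

Lemma mxord_zero k : mxord k (0 : 'M[A]_(m, r)).
Proof. by move=> i j t _; rewrite mxE. Qed.

Lemma mxordD k U V : mxord k U -> mxord k V -> mxord k (U + V).
Proof. by move=> Uk Vk i j t tk; rewrite mxE /= Uk // Vk // addr0. Qed.

Lemma mxordB k U V : mxord k U -> mxord k V -> mxord k (U - V).
Proof. by move=> Uk Vk i j t tk; rewrite !mxE mps_coefB Uk // Vk // subr0. Qed.

(** The m-adic topology is separated: this identifies the limits of convergent
    divisions. *)
Lemma mxord_inf U : (forall k, mxord k U) -> U = 0.
Proof.
move=> U0; apply/matrixP => i j; apply: mpsP => t.
by rewrite (U0 (mdeg t).+1) // mxE.
Qed.

Lemma lead_homog k U : mxhomog k (lead k U).
Proof.
move=> i j; rewrite mxE; apply/dhomogP => t; rewrite mcoeff_msupp mcoeff_hpart.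
by have [tk|_] := eqVneq (mdeg t) k; rewrite ?eqxx.
Qed.

Lemma leadB k U V : lead k (U - V) = lead k U - lead k V.
Proof.
apply/matrixP => i j; rewrite !mxE; apply/mpolyP => t.
by rewrite mcoeffB !mcoeff_hpart mps_coefB; case: ifP; rewrite ?subr0.
Qed.

Lemma lead_zero k : lead k (0 : 'M[A]_(m, r)) = 0.
Proof. by rewrite -(subrr 0) leadB subrr. Qed.

Lemma mxordS k U : mxord k U -> lead k U = 0 <-> mxord k.+1 U.
Proof.
move=> Uk; split=> [l0 i j t|Uk1].
  rewrite ltnS leq_eqVlt => /orP[/eqP tk|]; last exact: Uk.
  move/matrixP: l0 => /(_ i j)/(congr1 (mcoeff t)).
  by rewrite !mxE mcoeff_hpart mcoeff0 tk eqxx.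
apply/matrixP => i j; apply/mpolyP => t; rewrite !mxE mcoeff_hpart mcoeff0.
by case: eqP => // tk; apply: Uk1; rewrite tk.
Qed.

Lemma mxord_emb k W : mxhomog k W -> mxord k (emb W).
Proof.
move=> Wk i j t tk; rewrite mxE /=; apply: dhomog_nemf_coeff (Wk i j) _.
by rewrite ltn_eqF.
Qed.

Lemma lead_emb k W : mxhomog k W -> lead k (emb W) = W.
Proof.
move=> Wk; apply/matrixP => i j; apply/mpolyP => t; rewrite !mxE mcoeff_hpart.
by case: eqP => //= /eqP tk; rewrite (dhomog_nemf_coeff (Wk i j)).
Qed.

Lemma mxcomp_homog k W : mxhomog k (mxcomp k W).
Proof. by move=> i j; rewrite mxE; exact: pihomogP. Qed.

Lemma mxcomp_id k W : mxhomog k W -> mxcomp k W = W.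
Proof. by move=> Wk; apply/matrixP => i j; rewrite mxE pihomog_dE. Qed.

Lemma mxcompB k W W' : mxcomp k (W - W') = mxcomp k W - mxcomp k W'.
Proof. by apply/matrixP => i j; rewrite !mxE linearB. Qed.

Lemma mxcomp_sum k (J : Type) (s : seq J) (F : J -> 'M[R]_(m, r)) :
  mxcomp k (\sum_(i <- s) F i) = \sum_(i <- s) mxcomp k (F i).
Proof.
apply/matrixP => i j; rewrite !mxE summxE linear_sum summxE.
by apply: eq_bigr => h _; rewrite mxE.
Qed.

Lemma mxcomp_partition W :
  exists N, W = \sum_(k < N) mxcomp k W.
Proof.
exists (\max_(i < m) \max_(j < r) msize (W i j))%N.
apply/matrixP => i j; rewrite summxE.
rewrite [LHS](@pihomog_partitionE _ _ mdeg (\max_(i < m) \max_(j < r) msize (W i j))%N).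
  by apply: eq_bigr => k _; rewrite mxE.
apply: (leq_trans (leq_bigmax (F := fun j => msize (W i j)) j)).
exact: (leq_bigmax (F := fun i => \max_(j < r) msize (W i j))%N i).
Qed.

End Orders.

Lemma mxhomog1 r : mxhomog 0 (1%:M : 'M[R]_r).
Proof.
move=> i j; rewrite mxE; case: eqP => _; [exact: dhomog1|exact: rpred0].
Qed.

Lemma mxhomogM k l m r s (W : 'M[R]_(m, r)) (W' : 'M[R]_(r, s)) :
  mxhomog k W -> mxhomog l W' -> mxhomog (k + l) (W *m W').
Proof.
by move=> Wk Wl i j; rewrite mxE; apply: rpred_sum => h _; exact: dhomogM.
Qed.

Lemma mxcompM k l m r s (W : 'M[R]_(m, r)) (W' : 'M[R]_(r, s)) :
  mxhomog k W -> mxcomp (k + l) (W *m W') = W *m mxcomp l W'.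
Proof.
move=> Wk; have [N ->] := mxcomp_partition W'.
rewrite mulmx_sumr !mxcomp_sum mulmx_sumr; apply: eq_bigr => i _.
have [->|il] := eqVneq (i : nat) l.
  rewrite [mxcomp l (mxcomp l _)]mxcomp_id; last exact: mxcomp_homog.
  by rewrite mxcomp_id //; apply: mxhomogM => //; exact: mxcomp_homog.
have ne0 d p q (V : 'M[R]_(p, q)) e : mxhomog d V -> d != e -> mxcomp e V = 0.
  by move=> Vd de; apply/matrixP => a b; rewrite !mxE (pihomog_ne0 de).
have Wi : mxhomog (k + i) (W *m mxcomp i W').
  by apply: mxhomogM => //; exact: mxcomp_homog.
rewrite (ne0 _ _ _ _ _ (@mxcomp_homog _ _ i W') il) mulmx0.
by rewrite (ne0 _ _ _ _ _ Wi) // eqn_add2l.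
Qed.

Lemma mxcompM_lt k l m r s (W : 'M[R]_(m, r)) (W' : 'M[R]_(r, s)) :
  mxhomog k W -> (l < k)%N -> mxcomp l (W *m W') = 0.
Proof.
move=> Wk lk; apply/matrixP => i j; rewrite !mxE linear_sum big1 // => h _.
have [N ->] := mxcomp_partition W'.
rewrite summxE mulr_sumr linear_sum big1 // => e _.
apply: (@pihomog_ne0 _ _ mdeg (k + e)).
  by rewrite gtn_eqF // (leq_trans lk) // leq_addr.
by apply: dhomogM => //; exact: mxcomp_homog.
Qed.

Lemma mps_hpartM k l (f g : A) :
  (forall t, (mdeg t < k)%N -> mps_coef f t = 0) ->
  (forall t, (mdeg t < l)%N -> mps_coef g t = 0) ->
  (forall t, (mdeg t < k + l)%N -> mps_coef (f * g) t = 0) /\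
  mps_hpart (k + l) (f * g) = mps_hpart k f * mps_hpart l g.
Proof.
move=> fk gl; split=> [t tkl|].
  rewrite /= big1 // => -[t1 t2] /= /eqP tE.
  have [t1k|kt1] := ltnP (mdeg t1) k; first by rewrite fk ?mul0r.
  rewrite gl ?mulr0 // ltnNge; apply: contraL tkl => lt2.
  by rewrite tE mdegD -leqNgt leq_add.
apply/mpolyP => t; rewrite mcoeff_hpart mcoeffM.
case: eqP => [tE|tE].
  apply: eq_bigr => -[t1 t2] /= /eqP tt; rewrite !mcoeff_hpart.
  have {tt}tE : (mdeg t1 + mdeg t2 = k + l)%N by rewrite -mdegD -tt.
  case: (ltngtP (mdeg t1) k) => [lt1|gt1|e1]; first by rewrite fk ?mul0r.
    rewrite mul0r gl ?mulr0 //.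
    by rewrite -(ltn_add2l k) -tE ltn_add2r.
  by rewrite -(eqn_add2l k) -tE e1 eqxx.
rewrite big1 // => -[t1 t2] /= /eqP tt; rewrite !mcoeff_hpart.
case: eqP => e1; last by rewrite mul0r.
case: eqP => e2; last by rewrite mulr0.
by case: tE; rewrite tt mdegD e1 e2.
Qed.

Lemma mps_coefM_lt k (f g : A) :
  (forall t, (mdeg t < k)%N -> mps_coef f t = 0) ->
  forall t, (mdeg t < k)%N -> mps_coef (f * g) t = 0.
Proof.
move=> fk t tk; have [//|gl _] := @mps_hpartM k 0 f g fk.
by apply: gl; rewrite addn0.
Qed.

Section Products.
Variables (k l m r s : nat) (U : 'M[A]_(m, r)) (V : 'M[A]_(r, s)).
Hypotheses (Uk : mxord k U) (Vl : mxord l V).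

Lemma mxordM : mxord (k + l) (U *m V).
Proof.
move=> i j t tkl; rewrite mxE mps_coef_sum big1 // => h _.
by have [->] := mps_hpartM (Uk i h) (Vl h j).
Qed.

(** This is the ring structure of the associated graded ring of K[[X]]: in total
    degree k + l, only leading terms contribute to a product. *)
Lemma leadM : lead (k + l) (U *m V) = lead k U *m lead l V.
Proof.
apply/matrixP => i j; rewrite !mxE.
have hS (F : 'I_r -> A) : mps_hpart (k + l) (\sum_h F h) = \sum_h mps_hpart (k + l) (F h).
  apply/mpolyP => t; rewrite mcoeff_hpart mps_coef_sum raddf_sum /=.
  under [RHS]eq_bigr => h _ do rewrite mcoeff_hpart.
  by case: ifP => // _; rewrite big1.
rewrite hS; apply: eq_bigr => h _; rewrite !mxE.
by have [_ ->] := mps_hpartM (Uk i h) (Vl h j).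
Qed.

End Products.

(** * Powers of the maximal ideal *)

Lemma mps_coefMX (g : A) i t :
  mps_coef (g * mps_of_mpoly 'X_i) t =
  if (0 < t i)%N then mps_coef g (t - U_(i))%MM else 0.
Proof.
rewrite /=; case: ifP => ti.
  have Ut : (U_(i) <= t)%MM.
    by apply/mnm_lepP => j; rewrite mnm1E; case: eqP => // <-.
  have b1 : (mdeg (t - U_(i))%MM < (mdeg t).+1)%N by rewrite ltnS mdegB.
  have b2 : (mdeg (U_(i) : 'X_{1..n})%MM < (mdeg t).+1)%N.
    by rewrite ltnS mdeg1 lt0n mdeg_eq0; apply: contraTneq ti => ->; rewrite mnm0E.
  rewrite (bigD1 (BMultinom b1, BMultinom b2)) /= ?submK //.
  rewrite mcoeffX eqxx mulr1 big1 ?addr0 // => -[[k1 h1] [k2 h2]] /= /andP[/eqP tE ne].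
  rewrite mcoeffX; case: eqP => [k2E|_]; last by rewrite mulr0.
  case/eqP: ne; congr pair; apply: val_inj => //=.
  by rewrite tE -k2E addmK.
rewrite big1 // => -[[k1 h1] [k2 h2]] /= /eqP tE.
rewrite mcoeffX; case: eqP => [k2E|_]; last by rewrite mulr0.
by move: ti; rewrite tE mnmDE -k2E mnm1E eqxx addn1.
Qed.

(** Each monomial of f is assigned to one chosen variable X_i that divides it,
    and g_i collects the quotients by X_i of the monomials assigned to X_i. *)
Lemma maximal_idealP (k : nat) (f : A) :
  (forall t, (mdeg t < k.+1)%N -> mps_coef f t = 0) ->
  exists g : 'I_n -> A,
    f = \sum_i g i * mps_of_mpoly 'X_i /\
    forall i t, (mdeg t < k)%N -> mps_coef (g i) t = 0.
Proof.
move=> fk; pose v (t : 'X_{1..n}) := [pick j | (0 < t j)%N].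
exists (fun i => MPS (fun t => if v (t + U_(i))%MM == Some i
                                then mps_coef f (t + U_(i))%MM else 0)).
split=> [|i t tk]; last first.
  by rewrite /=; case: ifP => // _; rewrite fk // mdegD mdeg1 addn1 ltnS.
apply: mpsP => t; rewrite mps_coef_sum.
have tU i : (0 < t i)%N -> (t - U_(i) + U_(i))%MM = t.
  by move=> ti; apply: submK; apply/mnm_lepP => j; rewrite mnm1E; case: eqP => // <-.
case vt : (v t) => [i0|].
  have ti0 : (0 < t i0)%N by move: vt; rewrite /v; case: pickP => // i ? [<-].
  rewrite (bigD1 i0) // big1 ?addr0 => [|i /andP[_ ne]].
    by rewrite mps_coefMX ti0 /= tU // vt eqxx addr0.
  rewrite mps_coefMX; case: ifP => // ti /=; rewrite tU // vt.
  by case: eqP => // -[e]; rewrite e eqxx in ne.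
have t0 j : (0 < t j)%N = false by move: vt; rewrite /v; case: pickP.
rewrite big1 => [|i _]; last by rewrite mps_coefMX t0.
apply: fk; suff -> : t = 0%MM by rewrite mdeg0.
by apply/mnmP => j; rewrite mnm0E; apply/eqP; rewrite -leqn0 leqNgt t0.
Qed.

Lemma ideal_powP k (f : A) :
  ideal_pow mm k f <-> (forall t, (mdeg t < k)%N -> mps_coef f t = 0).
Proof.
elim: k f => [|k IH] f /=; first by [].
split.
  case=> s [sP ->] t tk; rewrite mps_coef_sum big_seq big1 // => p ps.
  have [[g pg] /IH p2] := sP p ps.
  have p1 u : (mdeg u < 1)%N -> mps_coef p.1 u = 0.
    rewrite ltnS leqn0 mdeg_eq0 pg => /eqP ->.
    by rewrite mps_coef_sum big1 // => i _; rewrite mps_coefMX mnm0E.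
  by have [->] := mps_hpartM p1 p2.
move=> /maximal_idealP[g [-> gk]].
elim/big_ind: _ => [|a b|i _]; [exact: smul0|exact: smulD|].
rewrite mulrC; apply: (smul_in (M := A^o)); last by apply/IH; exact: gk.
exists (fun j => (j == i)%:R); rewrite (bigD1 i) //= eqxx mul1r big1 ?addr0 //.
by move=> j /negbTE ->; rewrite mul0r.
Qed.

Lemma maximal_ideal_const (f : A) : mm f -> mps_coef f 0%MM = 0.
Proof.
by case=> g ->; rewrite mps_coef_sum big1 // => i _; rewrite mps_coefMX mnm0E.
Qed.

Lemma adic_image (N : lmodType A) b (al : {linear 'cV[A]_b -> N}) k u :
  mxord k u -> adic k (al u).
Proof.
move=> uk; rewrite [u]matrix_sum_delta linear_sum; apply: adic_sum => j _.
rewrite big_ord1 linearZ; apply: smul_in => //; apply/ideal_powP; exact: uk.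
Qed.

(** A surjection from a free module is strict for the m-adic filtrations. *)
Lemma adic_preim (N : lmodType A) b (al : {linear 'cV[A]_b -> N}) k x :
  (forall y, exists u, al u = y) -> adic k x -> exists2 u, mxord k u & al u = x.
Proof.
move=> sal [s [sP ->]]; elim: s sP => [|p s IH] sP.
  by exists 0; [exact: mxord_zero|rewrite linear0 big_nil].
have [q qs|u uk uE] := IH; first by apply: sP; rewrite inE qs orbT.
have [/ideal_powP p1 _] := sP p (mem_head _ _); have [v vE] := sal p.2.
exists (p.1 *: v + u); last by rewrite linearP vE uE big_cons.
apply: mxordD => // i j t tk; rewrite mxE.
exact: (mps_coefM_lt (v i j) p1).
Qed.

Lemma adic_mxord b k (u : 'cV[A]_b) : adic k u <-> mxord k u.
Proof.
split=> [uk|uk]; last exact: (adic_image idfun uk).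
by have [y|//|v vk <-] := @adic_preim _ b idfun k u; first by exists y.
Qed.

Lemma smul_maximal b (u : 'cV[A]_b) : smul mm setT u -> mxord 1 u.
Proof.
case=> s [sP ->] i j t; rewrite ltnS leqn0 mdeg_eq0 => /eqP ->.
rewrite summxE mps_coef_sum big_seq big1 // => p ps; rewrite mxE.
have [p1 _] := sP p ps.
have q1 w : (mdeg w < 1)%N -> mps_coef p.1 w = 0.
  by rewrite ltnS leqn0 mdeg_eq0 => /eqP ->; exact: maximal_ideal_const.
by apply: (mps_coefM_lt (p.2 i j) q1); rewrite mdeg0.
Qed.

Lemma mxord_cols k m r (U : 'M[A]_(m, r)) :
  (forall u : 'cV[A]_r, mxord k (U *m u)) <-> mxord k U.
Proof.
split=> [h i j t tk|Uk u].
  by have := h (delta_mx j 0) i 0 t tk; rewrite -colE mxE.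
by rewrite -[k]addn0; apply: mxordM.
Qed.

(** The order, which is defined through the images of all vectors, can be read
    off the entries. *)
Lemma orderE m r (U : 'M[A]_(m, r)) s :
  mxord s U -> ~ mxord s.+1 U -> Defs.order U = s.
Proof.
have hoP k : has_order U k <-> mxord k U /\ ~ mxord k.+1 U.
  have e d : (forall u : 'cV[A]_r, adic d (U *m u)) <-> mxord d U.
    rewrite -mxord_cols; split=> h u; [exact/adic_mxord|exact/adic_mxord].
  by rewrite /has_order !e.
move=> s1 s2; rewrite /Defs.order; case: xgetP => [k _ /hoP[k1 k2]|/(_ s) no].
  case: (ltngtP k s) => // lt.
  - by case: k2; exact: mxord_le lt s1.
  - by case: s2; exact: mxord_le lt k1.
by case: no; apply/hoP.
Qed.

(** * Initial modules *)

Lemma cols_mx (B : nzRingType) m r (q : 'I_r -> 'cV[B]_m) :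
  exists Q : 'M[B]_(m, r), forall j, col j Q = q j.
Proof.
exists (\matrix_(i, j) q j i 0) => j; apply/matrixP => i l.
by rewrite !mxE ord1.
Qed.

Lemma eq_mx_cols (B : nzRingType) m r (U V : 'M[B]_(m, r)) :
  (forall j, col j U = col j V) -> U = V.
Proof.
move=> UV; apply/matrixP => i j.
by have /matrixP/(_ i 0) := UV j; rewrite !mxE.
Qed.

Lemma mxord_col k m r (U : 'M[A]_(m, r)) :
  (forall j, mxord k (col j U)) -> mxord k U.
Proof. by move=> Uk i j t tk; have := Uk j i 0 t tk; rewrite mxE. Qed.

(** Completeness of A: the partial sums converge to a because each monomial of a
    is taken from the unique term of its degree. *)
Lemma homog_series k m r (w : nat -> 'M[R]_(m, r)) :
  (forall l, mxhomog (k + l) (w l)) ->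
  exists2 a : 'M[A]_(m, r), mxord k a &
    forall i, mxord (k + i) (a - \sum_(l < i) emb (w l)).
Proof.
move=> wh.
pose a : 'M[A]_(m, r) := \matrix_(i, j) MPS (fun t =>
  if (k <= mdeg t)%N then (w (mdeg t - k)%N i j)@_t else 0).
exists a => [i j t tk|d i j t td]; first by rewrite mxE /= leqNgt tk.
rewrite !mxE summxE mps_coefB mps_coef_sum.
under eq_bigr => l _ do rewrite mxE /=.
have wt l : (w l i j)@_t = if (k + l)%N == mdeg t then (w l i j)@_t else 0.
  by case: eqP => //= /eqP ne; rewrite (dhomog_nemf_coeff (wh l i j)) // eq_sym.
rewrite /=; case: leqP => kt; last first.
  rewrite big1 ?subrr // => l _; rewrite wt ifF //.
  by apply: gtn_eqF; rewrite (leq_trans kt) // leq_addr.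
have lt : (mdeg t - k < d)%N by rewrite ltn_subLR.
rewrite (bigD1 (Ordinal lt)) //= big1 ?addr0 ?subrr // => l.
rewrite -val_eqE /= => ne; rewrite wt ifF //.
by apply: contraNF ne => /eqP <-; rewrite addKn.
Qed.

(** Z is the initial module of N for the m-adic filtration of A^b.  Only the
    homogeneous elements of Z are compared with N; they determine Z in all uses,
    where Z is a graded submodule. *)
Definition is_init b (N : set 'cV[A]_b) (Z : set 'cV[R]_b) : Prop :=
  (forall k x, N x -> mxord k x -> Z (lead k x)) /\
  (forall k w, Z w -> mxhomog k w -> exists x, [/\ N x, mxord k x & lead k x = w]).

Section Division.
Variables (b c e : nat) (N : set 'cV[A]_b) (Z : set 'cV[R]_b).
Variable Psi : 'M[R]_(b, c).
Hypotheses (NZ : is_init N Z) (ZE : forall w, Z w <-> exists v, w = Psi *m v).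
Hypothesis Psi_e : mxhomog e Psi.

(** The leading form of an element of N lies in Z, the image of Psi, which has no
    nonzero element of degree less than e. *)
Lemma init_order x : N x -> mxord e x.
Proof.
move=> Nx; have : (e <= e)%N by []; move: {1 3}e => l.
elim: l => [|l IH le]; first by move=> _; exact: mxord0.
have xl := IH (ltnW le); apply/(mxordS xl).
have /ZE[v vE] := NZ.1 l x Nx xl.
by rewrite -(mxcomp_id (lead_homog l x)) vE (mxcompM_lt _ Psi_e).
Qed.

Variable Y : 'M[A]_(b, c).
Hypotheses (Y_e : mxord e Y) (Y_lead : lead e Y = Psi).
Hypothesis NY : forall x a, N x -> N (x - Y *m a).

(** The leading form of x in degree e + k is Psi a_k with a_k a form of degree k,
    so x - Y a_k has larger order; iterating gives x = Y a with a the sum of the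
    successive quotients. *)
Lemma init_division k x : N x -> mxord (e + k) x ->
  exists2 a, mxord k a & x = Y *m a.
Proof.
move=> Nx xk.
have step l y : exists a, N y -> mxord (e + l) y ->
    mxhomog l a /\ mxord (e + l).+1 (y - Y *m emb a).
  have [Ny|] := pselect (N y); last by exists 0.
  have [yl|] := pselect (mxord (e + l) y); last by exists 0.
  have /ZE[v vE] := NZ.1 _ _ Ny yl.
  have vl := mxcomp_homog l v; exists (mxcomp l v) => _ _; split=> //.
  have Yv := mxordM Y_e (mxord_emb vl).
  apply/(mxordS (mxordB yl Yv)).
  rewrite leadB (leadM Y_e (mxord_emb vl)) Y_lead (lead_emb vl).
  by rewrite -(mxcompM _ _ Psi_e) -vE (mxcomp_id (lead_homog _ _)) subrr.
have /choice[s sP] : forall p : nat * 'cV[A]_b, exists a, N p.2 ->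
    mxord (e + p.1) p.2 -> mxhomog p.1 a /\ mxord (e + p.1).+1 (p.2 - Y *m emb a).
  by case=> l y; exact: step.
(* The successive remainders; s (k + j) picks the quotient of the j-th one. *)
pose xs := fix xs i := if i is j.+1 then xs j - Y *m emb (s (k + j, xs j)%N) else x.
have xsP i : N (xs i) /\ mxord (e + (k + i)) (xs i).
  elim: i => [|i [Ni oi]]; first by rewrite addn0.
  have [_] := sP (_, _) Ni oi; rewrite -addnS -addnS /= => oi1.
  by split=> //; exact: NY.
pose w i := s ((k + i)%N, xs i).
have wh i : mxhomog (k + i) (w i).
  by have [Ni oi] := xsP i; have [] := sP (_, _) Ni oi.
have [a ak aP] := homog_series wh; exists a => //.
have xsE i : xs i = x - Y *m \sum_(l < i) emb (w l).
  elim: i => [|i IH]; first by rewrite big_ord0 mulmx0 subr0.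
  by rewrite /= {1}IH big_ord_recr /= mulmxDr opprD addrA.
apply/eqP; rewrite -subr_eq0; apply/eqP; apply: mxord_inf => i.
have -> : x - Y *m a = xs i - Y *m (a - \sum_(l < i) emb (w l)).
  by rewrite xsE mulmxBr opprB addrA subrK.
have le : (i <= e + (k + i))%N by rewrite addnA leq_addl.
apply: mxord_le le _; apply: mxordB; first by case: (xsP i).
by apply: mxordM.
Qed.

End Division.

(** The invariant of the induction along the resolution: N is a syzygy module of
    M, Z its initial module, and Z' the corresponding syzygy module of the pure
    resolution, identified with Z by a change of basis with constant entries.
    Using a pair of inverse matrices allows the two ranks to be equal without
    being convertible. *)
Definition compared b c (N : set 'cV[A]_b) (Z : set 'cV[R]_b)
    (Z' : set 'cV[R]_c) : Prop :=
  is_init N Z /\ exists (T : 'M[R]_(c, b)) (T' : 'M[R]_(b, c)),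
    [/\ mxhomog 0 T, mxhomog 0 T', T *m T' = 1%:M, T' *m T = 1%:M &
        forall w, Z w <-> Z' (T *m w)].

(** The case of a matrix of order greater than e matters only for U = 0, whose
    order is a default value; both sides are then zero. *)
Lemma initial_formE m r e (U : 'M[A]_(m, r)) :
  mxord e U -> (mxord e.+1 U -> U = 0) -> initial_form U = lead e U.
Proof.
move=> Ue Ue1; have [U0|Un] := pselect (mxord e.+1 U).
  by rewrite (Ue1 U0) lead_zero /initial_form; exact: lead_zero.
by rewrite /initial_form (orderE Ue Un).
Qed.

Lemma lead1 r : lead 0 (1%:M : 'M[A]_r) = 1%:M.
Proof.
have -> : (1%:M : 'M[A]_r) = emb 1%:M by rewrite map_mx1.
exact/lead_emb/mxhomog1.
Qed.

(** The induction step, for the maps phi and psi onto N and Z'.  The hypotheses on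
    the kernels of phi and psi say that both are minimal covers. *)
Lemma compared_next b c b' c' e (N : set 'cV[A]_b) (Z : set 'cV[R]_b)
    (Z' : set 'cV[R]_c) (phi : 'M[A]_(b, b')) (psi : 'M[R]_(c, c')) :
  compared N Z Z' ->
  (forall x, N x <-> exists v, x = phi *m v) ->
  (forall w, Z' w <-> exists v, w = psi *m v) ->
  mxhomog e psi ->
  (forall u : 'cV_b', phi *m u = 0 -> mxord 1 u) ->
  (forall v : 'cV_c', psi *m v = 0 -> mxcomp 0 v = 0) ->
  (forall w, Z w <-> exists v, w = initial_form phi *m v) /\
  compared [set u : 'cV_b' | phi *m u = 0] [set w : 'cV_b' | initial_form phi *m w = 0]
    [set v : 'cV_c' | psi *m v = 0].
Proof.
move=> [NZ [T [T' [T0 T'0 TT' T'T ZT]]]] NE Z'E psi_e phi_min psi_min.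
pose Psi := T' *m psi.
have Psi_e : mxhomog e Psi by rewrite -[e]add0n; exact: mxhomogM.
have ZE w : Z w <-> exists v, w = Psi *m v.
  rewrite ZT Z'E; split=> -[v vE]; exists v.
    by rewrite -mulmxA -vE mulmxA T'T mul1mx.
  by rewrite vE /Psi !mulmxA TT' mul1mx.
have Psi_min (v : 'cV_c') : Psi *m v = 0 -> mxcomp 0 v = 0.
  move=> v0; apply: psi_min.
  by rewrite -[psi]mul1mx -TT' -!mulmxA [T' *m _]mulmxA v0 mulmx0.
(* The columns of Y = phi Q are elements of N that lift the columns of Psi. *)
have /choice[q qP] (j : 'I_c') :
    exists q, mxord e (phi *m q) /\ lead e (phi *m q) = col j Psi.
  have Zj : Z (col j Psi) by apply/ZE; exists (delta_mx j 0); rewrite colE.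
  have hj : mxhomog e (col j Psi) by move=> i l; rewrite mxE.
  have [x [/NE[q ->] xe xl]] := NZ.2 _ _ Zj hj; by exists q.
have [Q QE] := cols_mx q; pose Y := phi *m Q.
have Yq j : col j Y = phi *m q j by rewrite !colE -mulmxA -colE QE.
have Y_e : mxord e Y by apply: mxord_col => j; rewrite Yq; case: (qP j).
have Y_lead : lead e Y = Psi.
  by apply: eq_mx_cols => j; rewrite -map_col Yq; case: (qP j).
have NY x (a : 'cV_c') : N x -> N (x - Y *m a).
  by move=> /NE[v ->]; apply/NE; exists (v - Q *m a); rewrite mulmxBr mulmxA.
have divide := init_division NZ ZE Psi_e Y_e Y_lead NY.
have /choice[p pE] (j : 'I_b') : exists a, col j phi = Y *m a.
  have Nj : N (col j phi) by apply/NE; exists (delta_mx j 0); rewrite colE.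
  have xe := init_order NZ ZE Psi_e Nj; rewrite -[e]addn0 in xe.
  by have [a _ ->] := divide _ _ Nj xe; exists a.
have [P PE] := cols_mx p.
have phiE : phi = Y *m P.
  by apply: eq_mx_cols => j; rewrite pE [col j (Y *m P)]colE -mulmxA -colE PE.
have phi_e : mxord e phi by rewrite phiE -[e]addn0; exact: mxordM.
have phi_lead : lead e phi = Psi *m lead 0 P.
  by rewrite {1}phiE -{1}[e]addn0 (leadM Y_e (@mxord0 _ _ P)) Y_lead.
(* phi (Q P - 1) = 0 and Y (P Q - 1) = 0, and both kernels have no constant
   terms. *)
have QP : lead 0 Q *m lead 0 P = 1%:M.
  rewrite -(leadM (@mxord0 _ _ Q) (@mxord0 _ _ P)) addn0 -lead1.
  apply/eqP; rewrite -subr_eq0 -leadB; apply/eqP/mxordS; first exact: mxord0.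
  apply: mxord_col => j; apply: phi_min.
  by rewrite colE mulmxA mulmxBr mulmxA -/Y -phiE mulmx1 subrr mul0mx.
have PQ : lead 0 P *m lead 0 Q = 1%:M.
  rewrite -(leadM (@mxord0 _ _ P) (@mxord0 _ _ Q)) addn0 -lead1.
  apply/eqP; rewrite -subr_eq0 -leadB; apply/eqP.
  apply: eq_mx_cols => j; rewrite -map_col -/(lead 0 _).
  rewrite -(mxcomp_id (lead_homog 0 (col j _))) Psi_min ?col0 //.
  rewrite -Y_lead -(leadM Y_e (@mxord0 _ _ _)) addn0 colE !mulmxA.
  by rewrite mulmxBr mulmxA -phiE mulmx1 subrr mul0mx lead_zero.
have inE : initial_form phi = Psi *m lead 0 P.
  rewrite -phi_lead; apply: initial_formE => // /(mxordS phi_e) l0.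
  have Psi0 : Psi = 0 by rewrite -[Psi]mulmx1 -PQ mulmxA -phi_lead l0 mul0mx.
  (* If Psi = 0 then, psi being a minimal cover, c' = 0. *)
  have c0 : (1%:M : 'M[R]_c') = 0.
    apply: eq_mx_cols => j; have h1 : mxhomog 0 (col j (1%:M : 'M[R]_c')).
      by move=> i l; rewrite mxE; exact: mxhomog1.
    by rewrite -(mxcomp_id h1) Psi_min ?col0 // Psi0 mul0mx.
  rewrite phiE; suff -> : P = 0 by rewrite mulmx0.
  apply/matrixP => i; have /matrixP/(_ i i)/eqP := c0.
  by rewrite !mxE eqxx oner_eq0.
have Psi0E (v : 'cV_c') : Psi *m v = 0 <-> psi *m v = 0.
  split=> v0; last by rewrite /Psi -mulmxA v0 mulmx0.
  by rewrite -[psi]mul1mx -TT' -!mulmxA [T' *m _]mulmxA v0 mulmx0.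
split=> [w|].
  rewrite ZE inE; split=> -[v ->]; last by exists (lead 0 P *m v); rewrite mulmxA.
  by exists (lead 0 Q *m v); rewrite -!mulmxA [lead 0 P *m _]mulmxA PQ mul1mx.
split; last first.
  exists (lead 0 P), (lead 0 Q); split=> //; [exact: lead_homog|exact: lead_homog|].
  by move=> w /=; rewrite inE -mulmxA Psi0E.
split=> [k u /= u0 uk|k w /= w0 wk].
  by rewrite inE -phi_lead -(leadM phi_e uk) u0 lead_zero.
have wk' := mxord_emb wk.
have : mxord (e + k).+1 (phi *m emb w).
  apply/mxordS; first exact: mxordM.
  by rewrite (leadM phi_e wk') phi_lead -inE (lead_emb wk).
(* Strictness: phi w has order at least e + k + 1, so it is also the image of an
   element of order k + 1, whose difference with w is the required lift. *)
rewrite -addnS => ow; have Nw : N (phi *m emb w) by apply/NE; exists (emb w).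
have [a ak aE] := divide _ _ Nw ow.
have Qa : mxord k.+1 (Q *m a) by rewrite -[k.+1]add0n; exact: mxordM.
exists (emb w - Q *m a); split.
- by rewrite /= mulmxBr mulmxA aE subrr.
- by apply: mxordB => //; apply: mxord_le (leqnSn k) Qa.
- rewrite leadB (lead_emb wk) (_ : lead k (Q *m a) = 0) ?subr0 //.
  by apply/mxordS => //; apply: mxord_le (leqnSn k) Qa.
Qed.

(** * The associated graded module and its augmentation *)

Section Augmentation.
Variables (M : lmodType A) (b : nat) (aug : {linear 'cV[A]_b -> M}).

(** Replacing x by its leading form changes aug x by an element of
    m^(k + 1) M. *)
Lemma gr_aug_lead k x : mxord k x -> gr_aug aug (lead k x) = gr_class k (aug x).
Proof.
move=> xk; have lk := lead_homog k x; have ek := mxord_emb lk.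
rewrite (gr_augE aug (k := k)); last by move=> j; exact: lk.
apply/eqP; rewrite eq_sym -subr_eq0 -gr_classN; last exact: adic_image.
rewrite -gr_classD; [|exact: adic_image|by apply: adicN; exact: adic_image].
apply/eqP; rewrite -linearB; have dk := mxordB xk ek.
apply/gr_class_eq0; first exact: adic_image.
by apply: adic_image; apply/(mxordS dk); rewrite leadB (lead_emb lk) subrr.
Qed.

Lemma gr_aug_graded k w :
  mxhomog k w -> gm_deg (g := associated_graded M) k (gr_aug aug w).
Proof.
move=> wk; have ek := mxord_emb wk; rewrite -(lead_emb wk) (gr_aug_lead ek).
by exists (aug (emb w)) => //; exact: adic_image.
Qed.

Hypothesis aug_surj : forall x, exists u, aug u = x.

Lemma gr_aug_surj x : exists w, gr_aug aug w = x.
Proof.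
have [N [f [fP ->]]] := gr_sum x.
have /choice[g gE] (i : nat) : exists w, gr_aug aug w = f i.
  have [y yi <-] := fP i; have [u ui uE] := adic_preim aug_surj yi.
  by exists (lead i u); rewrite (gr_aug_lead ui) uE.
by exists (\sum_(i < N) g i); rewrite linear_sum; apply: eq_bigr => i _; exact: gE.
Qed.

(** Strictness of aug corrects a form w with aug w in m^(k + 1) M by an element of
    order k + 1 to an element of the kernel of aug. *)
Lemma is_init_aug : is_init [set u | aug u = 0] [set w | gr_aug aug w = 0].
Proof.
split=> [k x /= x0 xk|k w /= w0 wk]; first by rewrite (gr_aug_lead xk) x0 gr_class0.
have ek := mxord_emb wk; move: w0; rewrite -{1}(lead_emb wk) (gr_aug_lead ek).
move=> /gr_class_eq0 -/(_ (adic_image aug ek)) /(adic_preim aug_surj)[u uk uE].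
exists (emb w - u); split; first by rewrite /= linearB /= uE subrr.
  by apply: mxordB => //; exact: mxord_le (leqnSn k) uk.
rewrite leadB (lead_emb wk) (_ : lead k u = 0) ?subr0 //.
by apply/mxordS => //; exact: mxord_le (leqnSn k) uk.
Qed.

End Augmentation.

(** Uniqueness of the decomposition into homogeneous components. *)
Lemma gm_deg_comp (E : graded_module n K) i (x : E) N (f : nat -> E) :
  gm_deg i x -> (forall l, gm_deg l (f l)) -> x = \sum_(l < N) f l ->
  x = if (i < N)%N then f i else 0.
Proof.
move=> xi fP xE; pose g l := (if (l < N)%N then f l else 0) - (if l == i then x else 0).
have gP l : gm_deg l (g l).
  apply: gm_degB; first by case: ifP => // _; exact: gm_deg0.
  by case: eqP => [->|_] //; exact: gm_deg0.
have iN : (i < N + i.+1)%N by rewrite addnS ltnS leq_addl.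
have := gm_direct gP (N := N + i.+1) _ iN; rewrite /g eqxx => h.
apply/esym/eqP; rewrite -subr_eq0; apply/eqP/h.
rewrite sumrB [X in _ - X](bigD1 (Ordinal iN)) //= eqxx.
rewrite [X in _ - (_ + X)]big1 => [|l]; last by rewrite -val_eqE /= => /negbTE ->.
rewrite big_split_ord /= [X in _ + X - _]big1 => [|l _]; last by rewrite ltnNge leq_addr.
rewrite !addr0 [X in _ - X]xE; apply/eqP; rewrite subr_eq0; apply/eqP.
by apply: eq_bigr => l _; rewrite ltn_ord.
Qed.

Lemma linear_mulmx_basis b c (V : lmodType R) (f : {linear 'cV[R]_b -> V})
    (g : {linear 'cV[R]_c -> V}) (Q : 'M[R]_(c, b)) w :
  (forall j, g (col j Q) = f (delta_mx j 0)) -> g (Q *m w) = f w.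
Proof.
move=> gf; rewrite [w]matrix_sum_delta linear_sum !linear_sum /=.
apply: eq_bigr => j _; rewrite big_ord1 -scalemxAr -colE !linearZ /=.
by rewrite gf.
Qed.

(** The start of the induction: R^b -> G(M) and eps are two minimal covers of
    G(M), so each factors through the other by a matrix, and the constant parts
    of these matrices are inverse to each other.  G(M) is generated in degree 0,
    whence the factorization of the first map can be chosen constant and
    intertwines the two maps exactly. *)
Lemma compared_aug (M : lmodType A) b c d (aug : {linear 'cV[A]_b -> M})
    (eps : {linear 'cV[R]_c -> associated_graded M}) :
  (forall x, exists u, aug u = x) -> (forall u, aug u = 0 -> mxord 1 u) ->
  (forall x, exists v, eps v = x) -> (forall v, eps v = 0 -> mxcomp 0 v = 0) ->
  graded_map (E := free_graded n K c d) eps ->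
  compared [set u | aug u = 0] [set w | gr_aug aug w = 0] [set v | eps v = 0].
Proof.
move=> aug_surj aug_min eps_surj eps_min eps_gr.
have NZ := is_init_aug aug_surj; split=> //.
have gr_min w : gr_aug aug w = 0 -> mxcomp 0 w = 0.
  have [N wE] := mxcomp_partition w; move=> w0.
  have c0 : gr_aug aug (mxcomp 0 w) = 0.
    have fP l : gm_deg (g := associated_graded M) l (gr_aug aug (mxcomp l w)).
      exact/gr_aug_graded/mxcomp_homog.
    have := gm_direct fP (N := N) _ (_ : 0 < N)%N.
    case: N wE => [|N] wE h.
      rewrite wE big_ord0 (_ : mxcomp 0 0 = 0) ?linear0 //.
      by apply/matrixP => i j; rewrite !mxE linear0.
    by apply: h => //; rewrite -linear_sum -wE.
  have [x [x0 xo <-]] := NZ.2 0%N _ c0 (mxcomp_homog _ _).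
  by apply/mxordS => //; exact: aug_min.
have delta0 r (j : 'I_r) : mxhomog 0 (delta_mx j 0 : 'cV[R]_r).
  by move=> i l; rewrite mxE; case: (_ && _); [exact: dhomog1|exact: rpred0].
(* A preimage of the class of aug e_j, cut down to its component of degree 0 in
   R(-d)^c; for d > 0 that component is zero. *)
have /choice[t tP] (j : 'I_b) :
    exists t, mxhomog 0 t /\ eps t = gr_aug aug (delta_mx j 0).
  have [v vE] := eps_surj (gr_aug aug (delta_mx j 0)).
  have [N [f [fP fE]]] := free_sum d v.
  have v0 : gm_deg (g := associated_graded M) 0 (eps v).
    by rewrite vE; exact: gr_aug_graded.
  have vS : eps v = \sum_(i < N) eps (f i) by rewrite {1}fE linear_sum.
  have := gm_deg_comp v0 (fun l => eps_gr l _ (fP l)) vS.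
  rewrite vE; case: ifP => _ E; last first.
    by exists 0; rewrite linear0 E; split=> // i l; rewrite mxE; exact: rpred0.
  exists (f 0%N); split=> // i l.
  rewrite ord1; have := fP 0%N i; rewrite /rdeg /= sub0n.
  by case: ifP => // _ ->; exact: rpred0.
have [T TE] := cols_mx t.
have TP w : eps (T *m w) = gr_aug aug w.
  by apply: linear_mulmx_basis => j; rewrite TE; case: (tP j).
have T0 : mxhomog 0 T.
  by move=> i j; have [h _] := tP j; have := h i 0; rewrite -TE mxE.
have /choice[s sP] (j : 'I_c) : exists s, gr_aug aug s = eps (delta_mx j 0).
  exact: gr_aug_surj.
have [S SE] := cols_mx s.
have SP v : gr_aug aug (S *m v) = eps v.
  apply: linear_mulmx_basis => j; rewrite SE; exact: sP.
exists T, (mxcomp 0 S); split=> //; first exact: mxcomp_homog.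
- rewrite -(mxcompM 0 _ T0) -[RHS](mxcomp_id (@mxhomog1 _)); apply/eqP.
  rewrite -subr_eq0 -mxcompB; apply/eqP/eq_mx_cols => j.
  rewrite [LHS](_ : _ = mxcomp 0 (col j (T *m S - 1%:M))); last by rewrite -map_col.
  rewrite eps_min ?col0 // colE mulmxBl linearB /= mul1mx -mulmxA TP SP.
  exact: subrr.
- rewrite [LHS](_ : _ = mxcomp 0 (S *m T)).
    rewrite -[RHS](mxcomp_id (@mxhomog1 _)); apply/eqP.
    rewrite -subr_eq0 -mxcompB; apply/eqP/eq_mx_cols => j.
    rewrite [LHS](_ : _ = mxcomp 0 (col j (S *m T - 1%:M))); last by rewrite -map_col.
    rewrite gr_min ?col0 // colE mulmxBl linearB /= mul1mx -mulmxA SP TP.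
    exact: subrr.
  apply: trmx_inj; rewrite trmx_mul !map_trmx trmx_mul.
  rewrite -[RHS]/(mxcomp (0 + 0) _) mxcompM // => i j; rewrite mxE; exact: T0.
- by move=> w /=; rewrite TP.
Qed.

(** * Minimality and grading of the initial complex *)

Lemma smul_irrelevant b (v : 'cV[R]_b) :
  smul (@irrelevant_ideal n K) setT v -> mxcomp 0 v = 0.
Proof.
case=> s [sP ->]; rewrite mxcomp_sum big_seq big1 // => p ps.
have [[g ->] _] := sP p ps; rewrite scaler_suml mxcomp_sum big1 // => i _.
rewrite mulrC -scalerA -mul_scalar_mx; apply: (@mxcompM_lt 1) => // j l.
by rewrite mxE; case: eqP => _; rewrite ?rpred0 // dhomogX; apply/eqP; exact: mdeg1.
Qed.

Lemma irrelevant_homog k (p : R) :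
  p \is k.-homog -> (0 < k)%N -> @irrelevant_ideal n K p.
Proof.
move=> pk k0; rewrite [p]mpolyE big_seq.
elim/big_ind: _ => [|x y [g ->] [h ->]|t tp].
- by exists (fun=> 0); rewrite big1 // => i _; rewrite mul0r.
- exists (fun i => g i + h i); rewrite -big_split /=.
  by apply: eq_bigr => i _; rewrite mulrDl.
have /existsP[i ti] : [exists i, t i != 0%N].
  have := dhomog_mf pk tp => /= tk; move: k0; rewrite -tk lt0n mdegE.
  by rewrite sum_nat_eq0 negb_forall.
have Ut : (U_(i) <= t)%MM.
  by apply/mnm_lepP => j; rewrite mnm1E; case: eqP => // <-; rewrite lt0n.
exists (fun j => if j == i then p@_t *: 'X_[t - U_(i)] else 0).
rewrite (bigD1 i) //= eqxx big1 ?addr0 => [|j /negbTE ->]; last by rewrite mul0r.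
by rewrite -scalerAl -mpolyXD submK.
Qed.

(** If the order is positive the entries are forms of positive degree, and if it
    is 0 the initial form of U is its constant part, which is zero. *)
Lemma initial_form_min m r (U : 'M[A]_(m, r)) (v : 'cV[R]_r) :
  mxord 1 U -> smul (@irrelevant_ideal n K) setT (initial_form U *m v).
Proof.
move=> U1; rewrite [_ *m v]matrix_sum_delta.
elim/big_ind: _ => [|x y|i _]; [exact: smul0|exact: smulD|].
rewrite big_ord1 mxE scaler_suml.
elim/big_ind: _ => [|x y|j _]; [exact: smul0|exact: smulD|].
rewrite mulrC -scalerA; apply: smulZ => //.
apply: smul_in => //; have := lead_homog (Defs.order U) U i j.
case: (posnP (Defs.order U)) => [o0 _|o0]; last by move=> /irrelevant_homog; apply.
rewrite /initial_form o0 -/(lead 0 U) (_ : lead 0 U = 0); last exact/mxordS.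
by rewrite mxE; exists (fun=> 0); rewrite big1 // => h _; rewrite mul0r.
Qed.

(** The truncated subtraction is harmless: a degree-preserving map from R(-d')
    to R(-d) is zero when d' < d. *)
Lemma graded_map_homog b c d d' (psi : 'M[R]_(c, b)) :
  graded_map (E := free_graded n K b d') (F := free_graded n K c d)
    (fun u => psi *m u) ->
  mxhomog (d' - d) psi.
Proof.
move=> psi_gr i j.
have dj : gm_deg (g := free_graded n K b d') d' (delta_mx j 0).
  move=> l; rewrite /rdeg /= leqnn subnn mxE.
  by case: (_ && _); [exact: dhomog1|exact: rpred0].
have := psi_gr _ _ dj i; rewrite -colE mxE /rdeg /=.
by case: ifP => // _ ->; exact: rpred0.
Qed.

Lemma homog_graded_map b c d e (psi : 'M[R]_(c, b)) : mxhomog e psi ->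
  graded_map (E := free_graded n K b (d + e)) (F := free_graded n K c d)
    (fun u => psi *m u).
Proof.
move=> psi_e k u uk i; rewrite mxE; move: uk; rewrite /= /free_deg /rdeg /= => uk.
case: (leqP (d + e) k) => [dek|kde]; last first.
  have u0 j : u j 0 = 0 by have := uk j; rewrite leqNgt kde.
  rewrite big1 => [|j _]; last by rewrite u0 mulr0.
  by case: ifP => // _; exact: rpred0.
rewrite (leq_trans (leq_addr e d) dek); apply: rpred_sum => j _.
have := uk j; rewrite dek => uj.
have -> : (k - d = e + (k - (d + e)))%N.
  by rewrite subnDA subnKC // leq_subRL // (leq_trans _ dek) // leq_addr.
exact: dhomogM.
Qed.

End PureResolutions.

Theorem theorem1p3 (K : fieldType) (n : nat) (M : lmodType (mps n K))
    (M_fg : finitely_generated M)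
    (GM_pure : has_pure_resolution (associated_graded M))
    (F : free_seq (mps n K))
    (aug : {linear 'cV[mps n K]_(fs_rank F 0) -> M})
    (F_res : min_free_resolution maximal_ideal aug) :
  min_graded_free_resolution (E := associated_graded M) (F := initial_seq F)
    (initial_shift F) (gr_aug aug).
Proof.
have [_ [d [P [eps [_ [P_res [eps_gr P_gr]]]]]]] := GM_pure.
have F_min i : mxord 1 (fs_map F i).
  by apply/mxord_cols => u; apply: smul_maximal; apply: (@mfr_min _ _ _ _ _ F_res).
have F_ker i (u : 'cV_(fs_rank F i.+1)) : fs_map F i *m u = 0 -> mxord 1 u.
  by move=> /(@mfr_exact _ _ _ _ _ F_res)[v ->]; move: v; apply/mxord_cols.
have aug_ker u : aug u = 0 -> mxord 1 u.
  by move=> /(@mfr_exact0 _ _ _ _ _ F_res)[v ->]; move: v; apply/mxord_cols.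
have P_ker i (v : 'cV_(fs_rank P i.+1)) : fs_map P i *m v = 0 -> mxcomp 0 v = 0.
  by move=> /(@mfr_exact _ _ _ _ _ P_res)[w ->];
    exact/smul_irrelevant/(@mfr_min _ _ _ _ _ P_res).
have eps_ker v : eps v = 0 -> mxcomp 0 v = 0.
  by move=> /(@mfr_exact0 _ _ _ _ _ P_res)[w ->];
    exact/smul_irrelevant/(@mfr_min _ _ _ _ _ P_res).
have stage0 := compared_aug (@mfr_surj _ _ _ _ _ F_res) aug_ker
  (@mfr_surj _ _ _ _ _ P_res) eps_ker eps_gr.
have P_homog i := graded_map_homog (P_gr i).
have [exact0 cmp0] := compared_next stage0 (@mfr_exact0 _ _ _ _ _ F_res)
  (@mfr_exact0 _ _ _ _ _ P_res) (P_homog 0%N) (F_ker 0%N) (P_ker 0%N).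
have step i Z (h : compared _ Z _) := compared_next h (@mfr_exact _ _ _ _ _ F_res i)
  (@mfr_exact _ _ _ _ _ P_res i) (P_homog i.+1) (F_ker i.+1) (P_ker i.+1).
have cmp i : compared [set u : 'cV_(fs_rank F i.+1) | fs_map F i *m u = 0]
    [set w : 'cV_(fs_rank F i.+1) | initial_form (fs_map F i) *m w = 0]
    [set v : 'cV_(fs_rank P i.+1) | fs_map P i *m v = 0].
  by elim: i => [|i IH]; [exact: cmp0 | case: (step i _ IH)].
split; last split.
- split.
  + exact: gr_aug_surj (@mfr_surj _ _ _ _ _ F_res).
  + exact: exact0.
  + by move=> i; have [] := step i _ (cmp i).
  + by move=> i u; apply: initial_form_min; exact: F_min.
  + exact: (@mfr_bound _ _ _ _ _ F_res).
  + exact: (@mfr_len _ _ _ _ _ F_res).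
- rewrite /initial_shift big_ord0 => k u uk; apply: gr_aug_graded => j l.
  by have := uk j; rewrite ord1 /rdeg /= subn0.
- move=> i; rewrite /initial_shift big_ord_recr /=.
  exact/homog_graded_map/lead_homog.
Qed.
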